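(* Let $q$ be a prime power, $r\geq1$, $\delta\geq2$ integers, $R=r+\delta-1$, and $\ell,s,m$ integers with $\ell\geq1$, $s\geq0$, such that (C1) $\gcd(q,R)=1$; (C2) $(s+1)r<\ell R$; (C3) $s+1\leq\ell<q$; (C4) $\ell R\leq m$. Let $a_1,\dots,a_\ell\in\mathbb{F}_q^*$ be distinct, $h=\prod_{i=1}^{\ell}(T^R-a_i)$, and let $P\in\mathbb{F}_q[T]$ be a monic irreducible polynomial of degree $m$ with $P\equiv1\pmod h$. Let $\alpha\in\mathbb{F}_{q^m}$ be a root of $P$ and $\bar\phi$ the Drinfeld module over $\mathbb{F}_{q^m}$ with $\bar\phi_T=\alpha+\tau$. Let \[\mathcal M=\Big\{\sum_{k=0}^{s}g_k(\tau)\,\bar\phi_{T^R}^{\,k}\ :\ g_k\in\mathbb{F}_{q^m}\{\tau\}_{\leq r-1}\Big\},\] let $W_i=\bar\phi[T^R-a_i]$ and let $\{\beta^{(i)}_1,\dots,\beta^{(i)}_R\}$ be an $\mathbb{F}_q$-basis of $W_i$ for $i=1,\dots,\ell$. Define $\mathrm{enc}:\mathcal M\to\mathbb{F}_{q^m}^{\ell R}$ by $f\mapsto\big(f(\beta^{(i)}_j)\big)_{1\leq i\leq\ell,\,1\leq j\leq R}$, where $f$ acts via $\tau^i\mapsto x^{q^i}$. Then $\mathrm{enc}(\mathcal M)$, viewed as a matrix code in $\mathbb{F}_q^{m\times\ell R}$ via an $\mathbb{F}_q$-basis of $\mathbb{F}_{q^m}$, is an optimal $(m\times\ell R,\ m(s+1)r,\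 \ell R-Rs-r+1,\ r,\ \delta)$ rank-metric code: it has $\mathbb{F}_q$-dimension $m(s+1)r$, minimum rank distance $\ell R-Rs-r+1$, and rank-locality $(r,\delta)$, and it attains the bound $d_R\leq n-k+1-(\lceil k/r\rceil-1)(\delta-1)$ with $n=\ell R$, $k=(s+1)r$.
   Context: $\mathbb{F}_{q^m}\{\tau\}$ is the twisted polynomial ring with $(a\tau^i)(b\tau^j)=ab^{q^i}\tau^{i+j}$, and $\mathbb{F}_{q^m}\{\tau\}_{\leq n}$ its elements of $\tau$-degree at most $n$. A Drinfeld module $\bar\phi:\mathbb{F}_q[T]\to\mathbb{F}_{q^m}\{\tau\}$ is the $\mathbb{F}_q$-algebra homomorphism determined by $\bar\phi_T$; $\bar\phi[a]$ is the $\mathbb{F}_q$-space of roots of the $q$-linearized polynomial obtained from $\bar\phi_a$ by $\tau^i\mapsto x^{q^i}$. A vector $x\in\mathbb{F}_{q^m}^n$ is identified with the matrix in $\mathbb{F}_q^{m\times n}$ whose $j$-th column is the coordinate vector of $x_j$ in a fixed $\mathbb{F}_q$-basis of $\mathbb{F}_{q^m}$; the rank distance is the rank of the difference of matrices. An $(m\times n,K,d_R,r,\delta)$ rank-metric code is an $\mathbb{F}_q$-subspace of $\mathbb{F}_q^{m\times n}$ of $\mathbb{F}_q$-dimension $K$, minimum rank distance $d_R$ and rank-locality $(r,\delta)$, where rank-locality $(r,\delta)$ means: for every column index $i$ there is $\Gamma(i)\ni i$ with $|\Gamma(i)|\leq r+\delta-1$ and the code restricted to the columns in $\Gamma(i)$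 has minimum rank distance at least $\delta$. Any $(m\times n, mk)$ code with $(r,\delta)$ rank-locality satisfies $d_R\leq n-k+1-(\lceil k/r\rceil-1)(\delta-1)$; optimal means equality. *)

(* Defs.v *)
From HB Require Import structures.
From mathcomp Require Import all_boot all_order all_algebra all_field.
Set Implicit Arguments. Unset Strict Implicit. Unset Printing Implicit Defensive.
Import GRing.Theory.
Local Open Scope ring_scope.

(* A twisted polynomial  sum_i c_i tau^i  is stored as its coefficient
   sequence, using the container {poly L}; only the coefficient list is
   used, the product below is the twisted one
   (a tau^i)(b tau^j) = a b^(q^i) tau^(i+j). *)
Section Twisted.
Variables (L : fieldType) (q : nat).

Definition tmul (p p' : {poly L}) : {poly L} :=
  \sum_(i < size p) \sum_(j < size p')
     (p`_i * p'`_j ^+ (q ^ i)) *: 'X^(i + j).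

Definition tpow (p : {poly L}) (k : nat) : {poly L} := iter k (tmul p) 1.

Definition teval (p : {poly L}) (x : L) : L :=
  \sum_(i < size p) p`_i * x ^+ (q ^ i).

End Twisted.

Section Drinfeld.
Variables (F : fieldType) (L : fieldExtType F) (q : nat) (alpha : L).

Definition phiT : {poly L} := alpha%:P + 'X.

Definition phi (a : {poly F}) : {poly L} :=
  \sum_(i < size a) tmul q ((a`_i)%:A)%:P (tpow q phiT i).

Definition dtorsion (a : {poly F}) : pred L :=
  [pred x | teval q (phi a) x == 0].

Definition in_M (R r s : nat) (f : {poly L}) : Prop :=
  exists g : 'I_s.+1 -> {poly L},
    (forall k, size (g k) <= r)%N /\
    f = \sum_(k < s.+1) tmul q (g k) (tpow q (phi 'X^R) k).

Definition enc_mx (m l R : nat) (e : m.-tuple L) (beta : 'I_l -> 'I_R -> L)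
    (f : {poly L}) : 'M[F]_(m, l * R) :=
  \matrix_(a < m, c < l * R)
     coord e a ((mxvec (\matrix_(i < l, j < R) teval q f (beta i j))) 0 c).

End Drinfeld.

Section RankMetric.
Variables (F : fieldType) (m n : nat).

Definition colrestr (S : {set 'I_n}) (A : 'M[F]_(m, n)) : 'M[F]_(m, #|S|) :=
  colsub (fun k : 'I_#|S| => enum_val k) A.

Definition min_rank_dist (C : {vspace 'M[F]_(m, n)}) (d : nat) : Prop :=
  (exists A B, [/\ A \in C, B \in C, A != B & \rank (A - B)%R = d]) /\
  (forall A B, A \in C -> B \in C -> A != B -> (d <= \rank (A - B)%R)%N).

Definition rank_locality (C : {vspace 'M[F]_(m, n)}) (r delta : nat) : Prop :=
  forall i : 'I_n, exists S : {set 'I_n},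
    [/\ i \in S, (#|S| <= r + delta - 1)%N &
        forall A B, A \in C -> B \in C -> colrestr S A != colrestr S B ->
          (delta <= \rank (colrestr S A - colrestr S B)%R)%N].

End RankMetric.

(* Main.v *)
(* On W_i the operator phi_(T^R) acts as the scalar a_i, so the
   W_i are eigenspaces of one F_q-linear map for distinct eigenvalues and their
   bases together form an F_q-free family of l R elements.  A twisted polynomial
   f <> 0 of degree d kills a space of dimension at most d, hence its matrix of
   values on N free elements has rank at least N - d.  With d = R s + r - 1 this
   gives injectivity, hence the dimension, and the distance bound; restricted to
   W_i a message becomes sum_k a_i^k g_k, of degree at most r - 1, which gives
   the locality.  A message of minimal rank is found by counting dimensions. *)
Require Import Defs.
From HB Require Import structures.
From mathcomp Require Import all_boot all_order all_algebra all_field.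
Set Implicit Arguments. Unset Strict Implicit. Unset Printing Implicit Defensive.
Import GRing.Theory.
Local Open Scope ring_scope.

(** * Degrees in the twisted polynomial ring *)

Section TwistedDegree.
Variables (L : fieldType) (q : nat).
Implicit Types f g : {poly L}.

Lemma size_tmul_leq f g : (size (tmul q f g) <= (size f + size g).-1)%N.
Proof.
apply: (leq_trans (size_sum _ _ _)); apply/bigmax_leqP=> i _.
apply: (leq_trans (size_sum _ _ _)); apply/bigmax_leqP=> j _.
apply: (leq_trans (size_scale_leq _ _)); rewrite size_polyXn.
rewrite -ltnS -addSn prednK ?addn_gt0 ?(leq_ltn_trans _ (ltn_ord i)) //.
by rewrite -addnS leq_add.
Qed.

Lemma coef_tmul f g n : (tmul q f g)`_n =
  \sum_(i < size f) \sum_(j < size g) (f`_i * g`_j ^+ (q ^ i)) * (n == i + j)%N%:R.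
Proof.
rewrite coef_sum; apply: eq_bigr => i _; rewrite coef_sum.
by apply: eq_bigr => j _; rewrite coefZ coefXn.
Qed.

(** Only the pair of top indices adds up to the sum of the degrees, so a single term of the double
    sum survives. *)
Lemma coef_tmul_top f g : f != 0 -> g != 0 ->
  (tmul q f g)`_((size f).-1 + (size g).-1) =
  lead_coef f * lead_coef g ^+ (q ^ (size f).-1).
Proof.
move=> nzf nzg; rewrite coef_tmul.
have lf : ((size f).-1 < size f)%N by rewrite prednK // size_poly_gt0.
have lg : ((size g).-1 < size g)%N by rewrite prednK // size_poly_gt0.
have le_ord (h : {poly L}) (k : 'I_(size h)) : (k <= (size h).-1)%N.
  by rewrite -ltnS prednK // (leq_ltn_trans _ (ltn_ord k)).
rewrite (bigD1 (Ordinal lf)) //= (bigD1 (Ordinal lg)) //= eqxx mulr1.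
rewrite !big1 ?addr0 // => [i nei|j nej].
  apply: big1 => j _; case: eqP => [eqn|]; last by rewrite mulr0.
  have lti : (i < (size f).-1)%N.
    rewrite ltn_neqAle le_ord andbT; apply: contra nei => /eqP ei.
    by apply/eqP/val_inj.
  by have := leq_add lti (le_ord _ j); rewrite addSn -eqn ltnn.
rewrite eqn_add2l; case: eqP => [ej|]; last by rewrite mulr0.
by case/eqP: nej; apply: val_inj.
Qed.

(** The top coefficient is a product of nonzero elements of a field, so degrees add despite the
    twist. *)
Lemma size_tmul f g : f != 0 -> g != 0 ->
  size (tmul q f g) = (size f + size g).-1.
Proof.
move=> nzf nzg; apply/eqP; rewrite eqn_leq size_tmul_leq /=.
have sf : (0 < size f)%N by rewrite size_poly_gt0.
have sg : (0 < size g)%N by rewrite size_poly_gt0.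
have -> : (size f + size g).-1 = ((size f).-1 + (size g).-1).+1.
  by case: (size f) sf (size g) sg => // ? _ [] // ? _; rewrite /= addnS.
apply: contraT; rewrite -leqNgt => /(nth_default 0)/eqP.
by rewrite coef_tmul_top // mulf_eq0 expf_eq0 !lead_coef_eq0 (negPf nzf) (negPf nzg) andbF.
Qed.

Lemma tmul0p g : tmul q 0 g = 0.
Proof. by rewrite /tmul size_poly0 big_ord0. Qed.

Lemma size_tpow f d k : size f = d.+1 -> size (tpow q f k) = (d * k).+1.
Proof.
move=> sf; elim: k => [|k IHk]; first by rewrite muln0 size_poly1.
rewrite /tpow iterS size_tmul; first by rewrite sf IHk mulnS addSn addnS.
  by rewrite -size_poly_gt0 sf.
by rewrite -size_poly_gt0 IHk.
Qed.

Lemma size_tmul_tpow (d r k : nat) (B g : {poly L}) :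
  size B = d.+1 -> (size g <= r)%N -> (size (tmul q g (tpow q B k)) <= d * k + r)%N.
Proof.
move=> sB sg; apply: (leq_trans (size_tmul_leq _ _)).
by rewrite (size_tpow _ sB) addnS /= addnC leq_add2l.
Qed.

(* The summands cannot cancel: those of index [k] have degrees in
   [[d k, d k + r)], and these windows are disjoint. *)
Lemma tsum_neq0 (d r n : nat) (B : {poly L}) (g : 'I_n -> {poly L}) k0 :
    (r <= d)%N -> size B = d.+1 -> (forall k, size (g k) <= r)%N ->
    g k0 != 0 -> \sum_(k < n) tmul q (g k) (tpow q B k) != 0.
Proof.
move=> le_rd sB; elim: n g k0 => [|n IHn] g k0 sg nz; first by case: k0 nz.
rewrite big_ord_recr /=.
(* If the last coefficient vanishes, [k0] lies among the first [n] indices and induction applies;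
   otherwise the last summand dominates all others. *)
have [g0|nzmax] := eqVneq (g ord_max) 0.
  rewrite g0 tmul0p addr0.
  case: (unliftP ord_max k0) nz => [k -> nz|->]; last by rewrite g0 eqxx.
  apply: (IHn (fun k => g (widen_ord (leqnSn n) k)) k) => //.
  rewrite (_ : widen_ord _ k = lift ord_max k) //.
  by apply: val_inj; rewrite /= /bump leqNgt ltn_ord.
have sBn := size_tpow n sB.
have nzBn : tpow q B n != 0 by rewrite -size_poly_gt0 sBn.
have small : (size (\sum_(k < n) tmul q (g (widen_ord (leqnSn n) k)) (tpow q B k))%R
              <= d * n)%N.
  apply: (leq_trans (size_sum _ _ _)); apply/bigmax_leqP=> k _.
  apply: (leq_trans (size_tmul_tpow _ sB (sg _))).
  apply: (@leq_trans (d * k.+1)); last by rewrite leq_mul2l ltn_ord orbT.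
  by rewrite mulnS addnC leq_add2r.
rewrite -size_poly_gt0 addrC size_polyDl size_tmul ?sBn ?addnS //=.
  by rewrite addn_gt0 size_poly_gt0 nzmax.
by rewrite (leq_ltn_trans small) // -addn1 addnC leq_add2r size_poly_gt0.
Qed.
End TwistedDegree.

(** * Twisted polynomials as [F]-linear operators on [L] *)

Section TwistedEval.
Variables (F : finFieldType) (L : fieldExtType F).
Local Notation q := #|F|.
Implicit Types (f g : {poly L}) (x y : L).

(** [q] is a power of the characteristic of [F], which is also that of [L]. *)
Lemma Frobenius_add i x y : (x + y) ^+ (q ^ i) = x ^+ (q ^ i) + y ^+ (q ^ i).
Proof.
have [p p_pr pcharFp] := finPcharP F.
apply: exprDn_pchar; rewrite pnatX; apply/orP; left.
rewrite (eq_pnat _ (pchar_lalg L)) (eq_pnat _ (pcharf_eq pcharFp)).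
have [n _ ->] : exists2 n, true & q = (p ^ n)%N.
  by rewrite (card_pprimeChar pcharFp); eexists.
by rewrite pnatX pnat_id.
Qed.

Lemma Frobenius_scale i (c : F) x : (c *: x) ^+ (q ^ i) = c *: x ^+ (q ^ i).
Proof.
rewrite exprZn; congr (_ *: _).
by elim: i => [|i IHi]; rewrite ?expr1 // expnSr exprM IHi expf_card.
Qed.

Lemma Frobenius_sum i (I : Type) (s : seq I) (P : pred I) (E : I -> L) :
  (\sum_(k <- s | P k) E k) ^+ (q ^ i) = \sum_(k <- s | P k) E k ^+ (q ^ i).
Proof.
apply: (big_morph (fun x => x ^+ (q ^ i))); first exact: Frobenius_add.
by rewrite expr0n expn_eq0 eqn0Ngt (ltnW (finNzRing_gt1 F)).
Qed.

Lemma teval_widen f n x : (size f <= n)%N ->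
  teval q f x = \sum_(i < n) f`_i * x ^+ (q ^ i).
Proof.
move=> le_n; rewrite /teval (big_ord_widen _ (fun i => f`_i * x ^+ (q ^ i)) le_n).
rewrite big_mkcond; apply: eq_bigr => i _; case: ltnP => // /(nth_default 0)->.
by rewrite mul0r.
Qed.

Lemma teval_linear f : linear (teval q f).
Proof.
move=> c x y; rewrite /teval scaler_sumr -big_split; apply: eq_bigr => i _ /=.
by rewrite Frobenius_add Frobenius_scale mulrDr scalerAr.
Qed.
HB.instance Definition _ f :=
  GRing.isLinear.Build F L L *:%R (teval q f) (teval_linear f).

Lemma tevalDl f g x : teval q (f + g) x = teval q f x + teval q g x.
Proof.
have le_D := size_polyD f g.
rewrite (teval_widen _ le_D) (teval_widen _ (leq_maxl _ (size g))).
rewrite (teval_widen _ (leq_maxr (size f) _)) -big_split; apply: eq_bigr => i _ /=.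
by rewrite coefD mulrDl.
Qed.

Lemma teval0l x : teval q 0 x = 0.
Proof. by rewrite /teval size_poly0 big_ord0. Qed.

Lemma teval_suml (I : Type) (s : seq I) (P : pred I) (E : I -> {poly L}) x :
  teval q (\sum_(k <- s | P k) E k) x = \sum_(k <- s | P k) teval q (E k) x.
Proof.
by apply: (big_morph (fun f => teval q f x)) => [f g|]; rewrite ?tevalDl ?teval0l.
Qed.

Lemma teval_monomial (c : L) n x : teval q (c *: 'X^n) x = c * x ^+ (q ^ n).
Proof.
have le_n : (size (c *: 'X^n) <= n.+1)%N.
  by apply: leq_trans (size_scale_leq _ _) _; rewrite size_polyXn.
rewrite (teval_widen _ le_n) big_ord_recr /= coefZ coefXn eqxx mulr1.
rewrite big1 ?add0r // => i _; rewrite coefZ coefXn.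
by rewrite (ltn_eqF (ltn_ord i)) mulr0 mul0r.
Qed.

(** Since a (b x^(q^j))^(q^i) = a b^(q^i) x^(q^(i+j)), the twist is exactly what turns products into
    compositions. *)
Lemma teval_tmul f g x : teval q (tmul q f g) x = teval q f (teval q g x).
Proof.
rewrite /tmul teval_suml {2 3}/teval; apply: eq_bigr => i _; rewrite Frobenius_sum mulr_sumr.
rewrite teval_suml; apply: eq_bigr => j _.
by rewrite teval_monomial exprMn -exprM -expnD addnC mulrA.
Qed.

Lemma teval1 x : teval q 1 x = x.
Proof. by rewrite -(expr0 'X) -[_ ^+ 0]scale1r teval_monomial expr1 mul1r. Qed.

Lemma teval_tpow f k x : teval q (tpow q f k) x = iter k (teval q f) x.
Proof.
by elim: k => [|k IHk]; rewrite ?teval1 // /tpow iterS teval_tmul -/(tpow q f k) IHk.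
Qed.

Lemma tevalC (c : L) x : teval q c%:P x = c * x.
Proof. by rewrite -[c%:P]mulr1 mul_polyC -(expr0 'X) teval_monomial expr1. Qed.

(* Root count of the [q]-polynomial attached to [f], of ordinary degree at
   most [q ^ d]. *)
Lemma dim_teval_ker f d (K : {vspace L}) :
    f != 0 -> (size f <= d.+1)%N -> (forall x, x \in K -> teval q f x = 0) ->
  (\dim K <= d)%N.
Proof.
move=> nzf sf vanish.
have q1 : (1 < q)%N := finNzRing_gt1 F.
pose lin : {poly L} := \sum_(i < size f) f`_i *: 'X^(q ^ i).
have linE x : lin.[x] = teval q f x.
  by rewrite horner_sum; apply: eq_bigr => i _; rewrite hornerZ hornerXn.
have slin : (size lin <= (q ^ d).+1)%N.
  apply: (leq_trans (size_sum _ _ _)); apply/bigmax_leqP=> i _.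
  apply: (leq_trans (size_scale_leq _ _)); rewrite size_polyXn ltnS leq_exp2l //.
  by rewrite -ltnS (leq_trans (ltn_ord i)).
have nzlin : lin != 0.
  (* As q > 1, the exponents q^i are distinct, so the coefficient of [lin] at q^(deg f) is the
     leading coefficient of [f]. *)
  apply: contraNneq nzf => lin0; rewrite -lead_coef_eq0 lead_coefE.
  have [sf0|sf0] := posnP (size f); first by rewrite nth_default ?sf0.
  have lf : ((size f).-1 < size f)%N by rewrite prednK.
  have := coef0 L (q ^ (size f).-1); rewrite -lin0 coef_sum (bigD1 (Ordinal lf)) //=.
  rewrite coefZ coefXn eqxx mulr1 big1 ?addr0 => [->//|i nei].
  rewrite coefZ coefXn eqn_exp2l // eq_sym.
  by rewrite (_ : (_ == _ :> nat) = false) ?mulr0 //; apply: contraNF nei.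
(* [finvect_type] gives [L] the finite structure needed to list the q^(dim K) elements of [K]. *)
pose rs := enum (K : {vspace finvect_type L}).
have urs : uniq rs := enum_uniq _.
have all_rs : all (root lin) rs.
  by apply/allP=> x; rewrite (@mem_enum (finvect_type L)) => Kx; apply/eqP; rewrite linE vanish.
have := max_poly_roots nzlin all_rs urs.
have -> : size rs = (q ^ \dim K)%N.
  transitivity #|(K : {vspace finvect_type L})|; first by rewrite cardE.
  exact: card_vspace.
by move=> /leq_trans/(_ slin); rewrite ltnS leq_exp2l.
Qed.

End TwistedEval.

(** * Free families and eigenvectors *)

Section Families.
Variables (F : fieldType) (V : vectType F).

Lemma free_mktupleP N (b : 'I_N -> V) :
  reflect (forall k : 'I_N -> F, \sum_c k c *: b c = 0 -> forall c, k c = 0)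
          (free (mktuple b)).
Proof.
apply: (iffP freeP) => indep k sum0; apply: indep;
  by rewrite -[RHS]sum0; apply: eq_bigr => c _; rewrite -tnth_nth tnth_mktuple.
Qed.

Lemma free_reindex N N' (b : 'I_N -> V) (h : 'I_N' -> 'I_N) :
  injective h -> free (mktuple b) -> free (mktuple (b \o h)).
Proof.
move=> h_inj /free_mktupleP indep; apply/free_mktupleP=> k sum0 d.
have k'E : \sum_(d' | h d' == h d) k d' = k d.
  by rewrite (big_pred1 d) // => d' /=; rewrite (inj_eq h_inj).
(* The relation is pushed forward along [h]; by injectivity each fibre sum has at most one term. *)
rewrite -k'E; apply: (indep (fun c => \sum_(d' | h d' == c) k d')).
rewrite -[RHS]sum0 [RHS](partition_big h xpredT) //=; apply: eq_bigr => c _.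
by rewrite scaler_suml; apply: eq_bigr => d' /eqP->.
Qed.

(** Applying p(B) to the zero sum gives sum_i p(a_i) y_i = 0 for every polynomial p; the product of
    the X - a_i over i <> i0 isolates y_(i0). *)
Lemma eigen_sum_eq0 (I : finType) (B : {linear V -> V}) (a : I -> F) (y : I -> V) :
    injective a -> (forall i, B (y i) = a i *: y i) -> \sum_i y i = 0 ->
  forall i, y i = 0.
Proof.
move=> a_inj eig sum0 i0.
have iterB k z : iter k B (\sum_i z i *: y i) = \sum_i (a i ^+ k * z i) *: y i.
  elim: k => [|k IHk] /=; first by apply: eq_bigr => i _; rewrite mul1r.
  rewrite IHk linear_sum; apply: eq_bigr => i _.
  by rewrite linearZ /= eig scalerA exprSr mulrAC.
have sum_horner (p : {poly F}) : \sum_i p.[a i] *: y i = 0.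
  under eq_bigr => i _ do rewrite horner_coef scaler_suml.
  rewrite exchange_big big1 //= => k _.
  under eq_bigr => i _ do rewrite -scalerA -[a i ^+ k]mulr1.
  rewrite -scaler_sumr -iterB.
  under eq_bigr do rewrite scale1r.
  rewrite sum0 (_ : iter k B 0 = 0) ?scaler0 //.
  by elim: (nat_of_ord k) => //= n ->; rewrite linear0.
have := sum_horner (\prod_(i | i != i0) ('X - (a i)%:P)).
rewrite (bigD1 i0) //= [X in _ + X]big1; last first.
  move=> i nei.
  by rewrite horner_prod (bigD1 i) //= hornerXsubC subrr mul0r scale0r.
rewrite addr0 => /eqP; rewrite scaler_eq0 horner_prod => /orP[|/eqP//].
rewrite prodf_seq_eq0 => /hasP[i _ /andP[nei]].
by rewrite hornerXsubC subr_eq0 => /eqP/a_inj ei; case/eqP: nei.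
Qed.

End Families.

(** [A] factors through its columns outside the image of [h], the second factor being the 0/1 matrix
    that puts them back in place. *)
Lemma rank_zero_cols (F : fieldType) m N (A : 'M[F]_(m, N)) (X : finType)
    (h : X -> 'I_N) : injective h -> (forall x i, A i (h x) = 0) ->
  (\rank A + #|X| <= N)%N.
Proof.
move=> h_inj A0; pose S := ~: (h @: X).
have cardS : (#|S| + #|X| = N)%N.
  by rewrite addnC -(card_imset _ h_inj) cardsC card_ord.
rewrite -[leqRHS]cardS leq_add2r.
have -> : A = colsub (fun k : 'I_#|S| => enum_val k) A
            *m \matrix_(k < #|S|, j < N) (enum_val k == j)%:R.
  apply/matrixP=> i j; rewrite mxE.
  transitivity (\sum_(c in S) A i c * (c == j)%:R); last first.
    by rewrite big_enum_val; apply: eq_bigr => k _; rewrite !mxE.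
  have [Sj|] := boolP (j \in S).
    rewrite (bigD1 j) //= eqxx mulr1 big1 ?addr0 // => c /andP[_ /negPf->].
    by rewrite mulr0.
  move=> nSj; have [x _ ->] : exists2 x, x \in X & j = h x.
    by apply/imsetP; rewrite inE negbK in nSj.
  rewrite A0 big1 // => c Sc; case: eqP => [ec|]; last by rewrite mulr0.
  by rewrite ec A0 mul0r.
exact: mulmx_max_rank.
Qed.

(** * Ranks of evaluation matrices *)

Section Rank.
Variables (F : finFieldType) (L : fieldExtType F) (m : nat) (e : m.-tuple L).
Hypothesis e_basis : basis_of fullv e.
Local Notation q := #|F|.

(** The family [b] is arbitrary so that one rank bound serves both the whole code and its
    restriction to a block. *)
Definition eval_mx N (b : 'I_N -> L) (f : {poly L}) : 'M[F]_(m, N) :=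
  \matrix_(i, c) coord e i (teval q f (b c)).

Lemma coord_fullv_inj (x : L) : (forall i, coord e i x = 0) -> x = 0.
Proof.
move=> x0; rewrite (coord_basis e_basis (memvf x)) big1 // => i _.
by rewrite x0 scale0r.
Qed.

(* A linear relation among the columns of [eval_mx b f] is an element of
   [ker f], so the defect of the rank is at most [\dim (ker f)]. *)
Lemma rank_eval_mx N (b : 'I_N -> L) (f : {poly L}) d :
    free (mktuple b) -> f != 0 -> (size f <= d.+1)%N ->
  (N <= d + \rank (eval_mx b f))%N.
Proof.
move=> b_free nzf sf; set A := eval_mx b f.
(* The rows of [K] form a basis of the relations among the columns of [A]; [w i] combines the [b c]
   with the coefficients of the i-th one. *)
pose K := row_base (kermx A^T).
have KA0 : K *m A^T = 0 by apply/sub_kermxP; rewrite eq_row_base.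
pose w i := \sum_c K i c *: b c.
have w_free : free (mktuple w).
  apply/free_mktupleP=> t sum0 i.
  have tK0 : (\row_i t i) *m K = 0.
    apply/rowP=> c; rewrite !mxE; move/free_mktupleP: b_free => b_indep.
    apply: (b_indep (fun c => \sum_j (\row_i t i) 0 j * K j c)).
    rewrite -[RHS]sum0; under [RHS]eq_bigr do rewrite scaler_sumr.
    rewrite exchange_big /=; apply: eq_bigr => c' _; rewrite scaler_suml.
    by apply: eq_bigr => j _; rewrite mxE scalerA.
  have /eqP := tK0; rewrite mulmx_free_eq0 ?row_base_free // => /eqP/rowP/(_ i).
  by rewrite !mxE.
have fw0 i : teval q f (w i) = 0.
  have -> : teval q f (w i) = \sum_c K i c *: teval q f (b c).
    by rewrite (linear_sum (teval q f)); apply: eq_bigr => c _; rewrite linearZ.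
  apply: coord_fullv_inj => a; have /matrixP/(_ i a) := KA0.
  rewrite !mxE => sum0; rewrite -[RHS]sum0 linear_sum; apply: eq_bigr => c _ /=.
  by rewrite linearZ !mxE.
(* There are N - rank A independent relations, and [w] is free. *)
have dimw : \dim <<mktuple w>> = (N - \rank A)%N.
  by apply/eqP; rewrite -(mxrank_tr A) -mxrank_ker -[X in _ == X](size_tuple (mktuple w)).
have := @dim_teval_ker _ _ f d <<mktuple w>>%VS nzf sf.
rewrite dimw leq_subLR addnC; apply=> x /coord_span->.
rewrite (linear_sum (teval q f)) big1 // => i _.
by rewrite -tnth_nth tnth_mktuple linearZ /= fw0 scaler0.
Qed.

End Rank.

Lemma dim_ffun (K : fieldType) (V : vectType K) (I : finType) :
  \dim {: {ffun I -> V}} = (#|I| * \dim {:V})%N.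
Proof. by rewrite !dimvf. Qed.

(** * The operators of the Drinfeld module *)

Section DrinfeldEval.
Variables (F : finFieldType) (L : fieldExtType F) (alpha : L).
Local Notation q := #|F|.

(** The operator of phi_p is p evaluated at that of phi_T; the range [n] is left free so that two
    polynomials can be compared term by term. *)
Lemma teval_phi (p : {poly F}) n (x : L) : (size p <= n)%N ->
  teval q (phi q alpha p) x =
  \sum_(i < n) p`_i *: iter i (teval q (phiT alpha)) x.
Proof.
move=> le_n; rewrite /phi teval_suml.
pose E i := p`_i *: iter i (teval q (phiT alpha)) x.
rewrite -[RHS]/(\sum_(i < n) E i) (bigID (fun i : 'I_n => (i < size p)%N)) /=.
rewrite [X in _ + X]big1 ?addr0 => [|i]; last first.
  by rewrite -leqNgt /E => /(nth_default 0)->; rewrite scale0r.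
rewrite -(big_ord_widen _ E le_n); apply: eq_bigr => i _.
by rewrite teval_tmul tevalC teval_tpow mulr_algl.
Qed.

(** Identifies the (T^n - c)-torsion with the [c]-eigenspace of phi_(T^n). *)
Lemma teval_phi_XnsubC n c (x : L) :
  teval q (phi q alpha ('X^n - c%:P)) x = teval q (phi q alpha 'X^n) x - c *: x.
Proof.
have le1 : (size ('X^n - c%:P : {poly F})%R <= n.+1)%N.
  rewrite (leq_trans (size_polyD _ _)) // size_polyN geq_max size_polyXn leqnn.
  by rewrite (leq_trans (size_polyC_leq1 _)).
rewrite (teval_phi _ le1) (@teval_phi _ n.+1) ?size_polyXn //.
under eq_bigr do rewrite coefB scalerBl.
rewrite sumrB; congr (_ - _); rewrite big_ord_recl coefC eqxx /=.
by rewrite big1 ?addr0 // => i _; rewrite coefC scale0r.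
Qed.

Lemma size_phi_Xn n : size (phi q alpha 'X^n) = n.+1.
Proof.
have sphiT : size (phiT alpha) = 2.
  by rewrite /phiT addrC size_polyDl size_polyX // (leq_ltn_trans (size_polyC_leq1 _)).
rewrite /phi size_polyXn big_ord_recr /= big1 => [|i _]; last first.
  by rewrite coefXn ltn_eqF // scale0r tmul0p.
rewrite add0r coefXn eqxx scale1r size_tmul ?oner_neq0 //.
  by rewrite size_poly1 (size_tpow _ _ sphiT) mul1n.
by rewrite -size_poly_gt0 (size_tpow _ _ sphiT).
Qed.

End DrinfeldEval.

(** * Messages and their values on the torsion spaces *)

Section Code.
Variables (F : finFieldType) (L : fieldExtType F) (alpha : L) (R r s : nat).
Local Notation q := #|F|.
Local Notation B := (phi q alpha 'X^R).
Local Notation coefs := {ffun 'I_s.+1 * 'I_r -> L}.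
Implicit Types G : coefs.

(** Messages are parametrised by coefficient arrays, row k holding g_k; these form an [F]-space
    whose dimension is immediate. *)
Definition code_poly G : {poly L} :=
  \sum_(k < s.+1) tmul q (rVpoly (\row_j G (k, j))) (tpow q B k).

Lemma in_MP f : in_M q alpha R r s f <-> exists G, f = code_poly G.
Proof.
split=> [[g [sg ->]]|[G ->]].
  exists [ffun kj => (poly_rV (g kj.1) : 'rV[L]_r) 0 kj.2].
  apply: eq_bigr => k _; congr tmul; rewrite -(poly_rV_K (sg k)); congr rVpoly.
  by apply/rowP=> j; rewrite [RHS]mxE ffunE.
by exists (fun k => rVpoly (\row_j G (k, j))); split=> // k; apply: size_poly.
Qed.

Lemma teval_rVpoly (v : 'rV[L]_r) x :
  teval q (rVpoly v) x = \sum_j v 0 j * x ^+ (q ^ j).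
Proof.
rewrite (teval_widen _ (size_poly _ _)).
by apply: eq_bigr => j _; rewrite coef_rVpoly_ord.
Qed.

Lemma teval_code_poly G x : teval q (code_poly G) x =
  \sum_(k < s.+1) \sum_(j < r) G (k, j) * iter k (teval q B) x ^+ (q ^ j).
Proof.
rewrite teval_suml; apply: eq_bigr => k _; rewrite teval_tmul teval_tpow teval_rVpoly.
by apply: eq_bigr => j _; rewrite mxE.
Qed.

Lemma teval_code_poly_linear x : linear (fun G => teval q (code_poly G) x).
Proof.
move=> c G G'; rewrite !teval_code_poly scaler_sumr -big_split; apply: eq_bigr => k _.
rewrite scaler_sumr -big_split; apply: eq_bigr => j _ /=.
by rewrite !ffunE mulrDl scalerAl.
Qed.

Lemma size_code_poly G : (r <= R)%N -> (size (code_poly G) <= R * s + r)%N.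
Proof.
move=> le_rR; apply: (leq_trans (size_sum _ _ _)); apply/bigmax_leqP=> k _.
apply: (leq_trans (size_tmul_tpow _ _ (size_phi_Xn alpha R) (size_poly _ _))).
by rewrite leq_add2r leq_mul2l -ltnS ltn_ord orbT.
Qed.

Lemma code_poly_neq0 G : (r <= R)%N -> G != 0 -> code_poly G != 0.
Proof.
move=> le_rR nzG; have [k nzk] : exists k, rVpoly (\row_j G (k, j)) != 0.
  apply/existsP; apply: contraNT nzG => /existsPn zG.
  apply/eqP/ffunP=> -[k j]; rewrite ffunE.
  have /negPn/eqP := zG k => /(congr1 (fun f : {poly L} => f`_j)).
  by rewrite coef_rVpoly_ord mxE coef0.
apply: (tsum_neq0 (g := fun k => rVpoly (\row_j G (k, j))) q le_rR _ _ nzk).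
  exact: size_phi_Xn.
by move=> k'; apply: size_poly.
Qed.

(* On the [a]-eigenspace of [B] the powers of [B] become scalars, so that
   a message restricts to a twisted polynomial of degree less than [r]. *)
Definition local_row (a : F) G : 'rV[L]_r := \row_j \sum_(k < s.+1) a ^+ k *: G (k, j).

Lemma iter_eigen (a : F) x k : teval q B x = a *: x ->
  iter k (teval q B) x = a ^+ k *: x.
Proof.
move=> eig; elim: k => [|k IHk]; first by rewrite scale1r.
by rewrite iterS IHk linearZ /= eig scalerA exprSr.
Qed.

(** The scalars a^k lie in [F], so the q-power maps fix them and they pass from the argument to the
    coefficients. *)
Lemma teval_local G a x : teval q B x = a *: x ->
  teval q (code_poly G) x = teval q (rVpoly (local_row a G)) x.
Proof.
move=> eig; rewrite teval_code_poly teval_rVpoly exchange_big; apply: eq_bigr => j _.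
rewrite mxE mulr_suml; apply: eq_bigr => k _ /=.
by rewrite (iter_eigen _ eig) Frobenius_scale scalerCA.
Qed.

Variables (l : nat) (a : 'I_l -> F) (beta : 'I_l -> 'I_R -> L).
Hypotheses (a_inj : injective a) (beta_free : forall i, free (mktuple (beta i)))
  (beta_eig : forall i j, teval q B (beta i j) = a i *: beta i j).

Definition flat_beta (c : 'I_(l * R)) : L := mxvec (\matrix_(i, j) beta i j) 0 c.

Lemma flat_betaE i j : flat_beta (mxvec_index i j) = beta i j.
Proof. by rewrite /flat_beta mxvecE mxE. Qed.

(** The block sums of a relation are eigenvectors, or zero, for distinct eigenvalues, so each
    vanishes; freeness inside the block finishes. *)
Lemma free_flat_beta : free (mktuple flat_beta).
Proof.
apply/free_mktupleP=> k sum0.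
have y0 := eigen_sum_eq0 (B := teval q B) a_inj
  (y := fun i => \sum_j k (mxvec_index i j) *: beta i j).
move=> c; case/mxvec_indexP: c => i j.
have /free_mktupleP indep := beta_free i.
apply: (indep (fun j => k (mxvec_index i j))) => {indep j}.
apply: y0 => [{}i|].
  rewrite linear_sum scaler_sumr; apply: eq_bigr => j _.
  by rewrite linearZ /= beta_eig !scalerA mulrC.
rewrite -[RHS]sum0 pair_bigA [RHS](reindex _ (curry_mxvec_bij _ _)).
by apply: eq_bigr => -[i' j'] _ /=; rewrite flat_betaE.
Qed.


Lemma mxvec_index_inj2 n p (i i' : 'I_n) (j j' : 'I_p) :
  mxvec_index i j = mxvec_index i' j' -> (i, j) = (i', j').
Proof. by move/cast_ord_inj/enum_rank_inj. Qed.

(** * Dimension, minimum distance and locality of the code *)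

Variables (m : nat) (e : m.-tuple L).
Hypotheses (e_basis : basis_of fullv e) (le_rR : (r <= R)%N).

Definition code_mx G := enc_mx q e beta (code_poly G).

Lemma code_mxE G : code_mx G = eval_mx e flat_beta (code_poly G).
Proof.
apply/matrixP=> i c; rewrite !mxE; case/mxvec_indexP: c => j k.
by rewrite flat_betaE mxvecE mxE.
Qed.

Lemma code_mx_linear : linear code_mx.
Proof.
move=> c G G'; rewrite !code_mxE; apply/matrixP=> i k.
by rewrite !mxE teval_code_poly_linear linearP.
Qed.
HB.instance Definition _ :=
  GRing.isLinear.Build F coefs 'M[F]_(m, l * R) *:%R code_mx code_mx_linear.

Definition code : {vspace 'M[F]_(m, l * R)} := limg (linfun code_mx).

Lemma mem_codeP A : reflect (exists G, A = code_mx G) (A \in code).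
Proof.
apply: (iffP memv_imgP) => [[G _ ->]|[G ->]]; exists G;
  by rewrite ?memvf ?lfunE.
Qed.

Lemma rank_code_mx G : (0 < r)%N -> G != 0 ->
  (l * R <= R * s + r.-1 + \rank (code_mx G))%N.
Proof.
move=> r0 nzG; rewrite code_mxE; apply: rank_eval_mx => //.
- exact: free_flat_beta.
- exact: code_poly_neq0.
- by rewrite -addnS prednK // size_code_poly.
Qed.

(** The largest message degree stays below the length, so every nonzero message has a codeword of
    positive rank. *)
Lemma code_degree_lt : (0 < r)%N -> (s < l)%N -> (R * s + r.-1 < l * R)%N.
Proof.
move=> r0 lt_sl; rewrite (@leq_trans (R * s.+1)) ?(mulnC l) ?leq_mul2l ?lt_sl ?orbT //.
by rewrite mulnS addnC ltn_add2r prednK.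
Qed.

(** Positive rank makes the encoding injective, so the coefficient arrays are counted, with [L : F]
    = m read off the basis [e]. *)
Lemma dim_code : (0 < r)%N -> (s < l)%N ->
  \dim code = (m * (s.+1 * r))%N.
Proof.
move=> r0 /(code_degree_lt r0) lt_d; rewrite limg_dim_eq; last first.
  apply/eqP; rewrite capfv; apply/lker0P=> G G'; rewrite !lfunE /= => /eqP.
  rewrite -subr_eq0 -linearB /= => eq0; apply/eqP; rewrite -subr_eq0.
  apply: contraLR lt_d => nz; rewrite -leqNgt.
  by rewrite (leq_trans (rank_code_mx r0 nz)) // (eqP eq0) mxrank0 addn0.
by rewrite dim_ffun card_prod !card_ord (size_basis e_basis) mulnC.
Qed.

(* Vanishing on [W_0, ..., W_(s-1)] costs [s r] conditions over [L], since a
   message has degree less than [r] on each of them; vanishing on [r - 1] more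
   vectors leaves one of the [(s + 1) r] degrees of freedom. *)
Lemma code_mx_min : (0 < r)%N -> (s < l)%N ->
  exists2 G, G != 0 & (\rank (code_mx G) + (s * R + r.-1) <= l * R)%N.
Proof.
move=> r0 lt_sl; pose il := Ordinal lt_sl.
have le_r1R : (r.-1 <= R)%N by rewrite (leq_trans (leq_pred r)).
pose w : 'I_s -> 'I_l := widen_ord (ltnW lt_sl).
(* The target has s r + r - 1 coordinates in [L], one fewer than the arrays, so the kernel is
   nonzero. *)
pose cond G : {ffun 'I_s * 'I_r + 'I_r.-1 -> L} := [ffun x => match x with
  | inl ij => local_row (a (w ij.1)) G 0 ij.2
  | inr j => teval q (code_poly G) (beta il (widen_ord le_r1R j)) end].
have cond_lin : linear cond.
  move=> c G G'; apply/ffunP=> -[[i j]|j]; rewrite !ffunE /=; last first.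
    exact: teval_code_poly_linear.
  rewrite !mxE scaler_sumr -big_split; apply: eq_bigr => k _ /=.
  by rewrite !ffunE scalerDr !scalerA mulrC.
pose condL : {linear coefs -> {ffun 'I_s * 'I_r + 'I_r.-1 -> L}} :=
  HB.pack cond (GRing.isLinear.Build _ _ _ _ cond cond_lin).
pose K := lker (linfun condL).
have nzK : K != 0%VS.
  apply/eqP => K0; have := limg_ker_dim (linfun condL) fullv.
  rewrite capfv -/K K0 dimv0 add0n => dims.
  have := dimvS (subvf (limg (linfun condL))); rewrite dims !dim_ffun.
  rewrite leq_pmul2r ?adim_gt0 // card_sum !card_prod !card_ord mulSn addnC leq_add2l.
  by rewrite leqNgt prednK // leqnn.
exists (vpick K); first by rewrite vpick0.
have cond0 : cond (vpick K) = 0.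
  by have := memv_pick K; rewrite memv_ker lfunE => /eqP.
(* The zero columns: all R columns of each of the first s blocks, although only r conditions were
   spent on each, and r - 1 columns of block [il]. *)
pose h (x : 'I_s * 'I_R + 'I_r.-1) : 'I_(l * R) := match x with
  | inl ij => mxvec_index (w ij.1) ij.2
  | inr j => mxvec_index il (widen_ord le_r1R j) end.
have h_inj : injective h.
  move=> [[i j]|j] [[i' j']|j'] /mxvec_index_inj2[] /=.
  - by move=> /val_inj-> ->.
  - by move=> ei; have := ltn_ord i; rewrite ei ltnn.
  - by move=> ei; have := ltn_ord i'; rewrite -ei ltnn.
  - by move=> /val_inj->.
have := rank_zero_cols (A := code_mx (vpick K)) h_inj.
rewrite card_sum card_prod !card_ord; apply=> x i.
rewrite code_mxE mxE; case: x => [[i' j']|j] /=; rewrite flat_betaE.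
  rewrite (teval_local _ (beta_eig _ _)) teval_rVpoly big1 ?linear0 // => j _.
  by have /ffunP/(_ (inl (i', j))) := cond0; rewrite !ffunE /= => ->; rewrite mul0r.
by have /ffunP/(_ (inr j)) := cond0; rewrite !ffunE /= => ->; rewrite linear0.
Qed.

Lemma min_rank_dist_code : (0 < r)%N -> (s < l)%N ->
  min_rank_dist code (l * R - R * s - r + 1).
Proof.
move=> r0 lt_sl.
have lt_d := code_degree_lt r0 lt_sl.
(* With truncated subtraction this needs R s + r <= l R, which is [lt_d]. *)
have dE : (l * R - R * s - r + 1 = l * R - (R * s + r.-1))%N.
  have rE : (R * s + r = (R * s + r.-1).+1)%N by rewrite -addnS prednK.
  by rewrite -subnDA rE subnS addn1 prednK // subn_gt0.
split=> [|A A' /mem_codeP[G ->] /mem_codeP[G' ->] neqA].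
  have [G nzG le_rk] := code_mx_min r0 lt_sl.
  exists (code_mx G), 0; rewrite mem0v subr0; split=> //.
  - by apply/mem_codeP; exists G.
  - apply: contraTneq lt_d => G0; rewrite -leqNgt.
    by rewrite (leq_trans (rank_code_mx r0 nzG)) // G0 mxrank0 addn0.
  (* The lower bound holds for every nonzero message; the upper one is the choice of [G]. *)
  apply/eqP; rewrite dE eqn_leq leq_subLR rank_code_mx // andbT.
  by rewrite leq_subRL ?(ltnW lt_d) // addnC (mulnC R).
rewrite dE leq_subLR -linearB rank_code_mx //.
by apply: contraNneq neqA => /eqP; rewrite subr_eq0 => /eqP->.
Qed.

(** The recovery set of a column is its whole block, where a message acts with degree at most r - 1
    on R free elements: the rank is at least R - (r - 1) = delta. *)
Lemma rank_locality_code delta : (0 < r)%N -> R = (r + delta - 1)%N ->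
  rank_locality code r delta.
Proof.
move=> r0 RE c; case/mxvec_indexP: c => i j0.
pose S := [set mxvec_index i j | j : 'I_R].
have cardS : #|S| = R.
  by rewrite card_imset ?card_ord // => j j' /mxvec_index_inj2[].
exists S; split; [exact: imset_f | by rewrite cardS RE |].
move=> A A' /mem_codeP[G ->] /mem_codeP[G' ->].
have colrestrB (M N : 'M[F]_(m, l * R)) :
  colrestr S M - colrestr S N = colrestr S (M - N).
  by apply/matrixP=> x y; rewrite !mxE.
rewrite -subr_eq0 colrestrB -linearB /=; set D := G - G'.
pose b := flat_beta \o (enum_val : 'I_#|S| -> _).
pose f := rVpoly (local_row (a i) D).
have -> : colrestr S (code_mx D) = eval_mx e b f.
  rewrite code_mxE; apply/matrixP=> x y; rewrite !mxE /b /=.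
  have /imsetP[j _ ->] := enum_valP y.
  by rewrite flat_betaE (teval_local _ (beta_eig _ _)).
(* A nonzero [D] may still vanish on this block; it is the difference of the restrictions that
   forces [f] to be nonzero. *)
move=> nz; have nzf : f != 0.
  apply: contraNneq nz => ->; apply/eqP/matrixP=> x y.
  by rewrite !mxE teval0l linear0.
have b_free : free (mktuple b) := free_reindex enum_val_inj free_flat_beta.
have sf : (size f <= r.-1.+1)%N by rewrite prednK // size_poly.
apply: (@leq_trans (#|S| - r.-1)); last by rewrite leq_subLR rank_eval_mx.
by rewrite cardS RE subn1 -[in X in (X + _).-1](prednK r0) addSn addKn.
Qed.

End Code.

(** * Assembly of the parameters and attainment of the bound *)

Theorem theorem3p4 (F : finFieldType) (L : fieldExtType F)
  (q r delta l s m : nat)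
  (hq : #|F| = q) (hr : (1 <= r)%N) (hdelta : (2 <= delta)%N) (hl : (1 <= l)%N)
  (C1 : coprime q (r + delta - 1))
  (C2 : ((s + 1) * r < l * (r + delta - 1))%N)
  (C3 : (s + 1 <= l < q)%N)
  (C4 : (l * (r + delta - 1) <= m)%N)
  (a : 'I_l -> F) (a_inj : injective a) (a_nz : forall i, a i != 0)
  (P : {poly F}) (P_monic : P \is monic) (P_irr : irreducible_poly P)
  (P_deg : size P = m.+1)
  (P_cong : (\prod_(i < l) ('X^(r + delta - 1) - (a i)%:P)) %| (P - 1))
  (alpha : L) (alpha_root : root (map_poly (in_alg L) P) alpha)
  (beta : 'I_l -> 'I_(r + delta - 1) -> L)
  (beta_basis : forall i : 'I_l,
     free [tuple beta i j | j < r + delta - 1] /\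
     forall x : L, (x \in <<[tuple beta i j | j < r + delta - 1]>>%VS) =
       (x \in dtorsion q alpha ('X^(r + delta - 1) - (a i)%:P)))
  (e : m.-tuple L) (e_basis : basis_of fullv e) :
  exists C : {vspace 'M[F]_(m, l * (r + delta - 1))},
    [/\ forall A, A \in C <->
          exists f, in_M q alpha (r + delta - 1) r s f /\
                    A = enc_mx q e beta f,
        \dim C = (m * ((s + 1) * r))%N,
        min_rank_dist C (l * (r + delta - 1) - (r + delta - 1) * s - r + 1),
        rank_locality C r delta &
        (l * (r + delta - 1) - (r + delta - 1) * s - r + 1 =
         l * (r + delta - 1) - (s + 1) * r + 1
           - (((s + 1) * r + r - 1) %/ r - 1) * (delta - 1))%N].
Proof.
case/andP: C3 => le_sl _; subst q.
have r_lt : (r < r + delta - 1)%N.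
  by rewrite -addnBA ?(ltnW hdelta) // -addn1 leq_add2l subn_gt0.
have lt_sl : (s < l)%N by rewrite -addn1.
have beta_free i : free (mktuple (beta i)) := (beta_basis i).1.
have beta_eig i j : teval #|F| (phi #|F| alpha 'X^(r + delta - 1)) (beta i j) =
    a i *: beta i j.
  have : beta i j \in dtorsion #|F| alpha ('X^(r + delta - 1) - (a i)%:P).
    by rewrite -(beta_basis i).2 memv_span // -(tnth_mktuple (beta i)) mem_tnth.
  by rewrite inE teval_phi_XnsubC subr_eq0 => /eqP.
exists (code alpha r s beta e); split.
- move=> A; split=> [/mem_codeP[G ->]|[f [/in_MP[G ->] ->]]]; last first.
    by apply/mem_codeP; exists G.
  by exists (code_poly alpha (r + delta - 1) G); split=> //; apply/in_MP; exists G.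
- by rewrite addn1; apply: (dim_code a_inj); rewrite // ltnW.
- by apply: (min_rank_dist_code a_inj) => //; rewrite ltnW.
- exact: (rank_locality_code s a_inj beta_free beta_eig e_basis hr erefl).
(* The ceiling of k / r is written (k + r - 1) %/ r; here r divides k. *)
have -> : (((s + 1) * r + r - 1) %/ r = s.+1)%N.
  by rewrite addn1 -addnBA // divnMDl // divn_small ?addn0 // subn1 prednK.
have sumE : ((r + delta - 1) * s + r = (s + 1) * r + s * (delta - 1))%N.
  by rewrite -addnBA ?(ltnW hdelta) // mulnC mulnDr mulnDl mul1n addnAC.
(* Ensures that no subtraction in the bound is truncated. *)
have le_sum : ((s + 1) * r + s * (delta - 1) <= l * (r + delta - 1))%N.
  rewrite -sumE (@leq_trans ((r + delta - 1) * s.+1)) ?(mulnC l) ?leq_mul2l ?lt_sl ?orbT //.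
  by rewrite mulnS addnC leq_add2r ltnW.
by rewrite -subnDA sumE subnDA subSS subn0 addnBAC // leq_subRL ?(leq_trans (leq_addr _ _) le_sum).
Qed.
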